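(* Let $p \ge 1$ and $n \ge 2$ be integers such that $c=\gcd(p,n)$ is prime, and let $d=n/c$. Let $\mathcal{T}(p,2)$ be the $(p,2)$-torus link and let $\mathbb{Z}_n$ be the dihedral quandle of order $n$. Then the full $\mathbb{Z}_n$-quandle coloring quiver of $\mathcal{T}(p,2)$ is (up to isomorphism of directed multigraphs) the join of two complete directed graphs $$\mathcal{Q}_{\mathbb{Z}_n}(\mathcal{T}(p,2)) = \left(\overleftrightarrow{K_{n}},\hat{n}\right)\ \overleftarrow{\nabla}_{\hat{d}}\ \left(\overleftrightarrow{K_{n(c-1)}},\hat{d}\right),$$ where the complete subgraph $(\overleftrightarrow{K_{n}},\hat{n})$ corresponds to the trivial $\mathbb{Z}_n$-quandle colorings of $\mathcal{T}(p,2)$ and the complete subgraph $(\overleftrightarrow{K_{n(c-1)}},\hat{d})$ corresponds to the nontrivial $\mathbb{Z}_n$-quandle colorings of $\mathcal{T}(p,2)$.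
   Context: A quandle is a non-empty set $X$ with a binary operation $\triangleright$ such that: (1) $x\triangleright x=x$ for all $x$; (2) for every $y$ the map $x\mapsto x\triangleright y$ is invertible; (3) $(x\triangleright y)\triangleright z=(x\triangleright z)\triangleright(y\triangleright z)$ for all $x,y,z$. A quandle homomorphism is a map $f$ with $f(a\triangleright b)=f(a)\triangleright f(b)$; $Hom(X,Y)$ denotes the set of quandle homomorphisms $X\to Y$. The dihedral quandle $\mathbb{Z}_n$ ($n\ge 2$) is $\{0,1,\dots,n-1\}$ with $x\triangleright y=(2y-x) \bmod n$. The $(p,2)$-torus link $\mathcal{T}(p,2)$, $p\ge1$, is the closure of the 2-strand braid $\sigma_1^p$. Its fundamental quandle $Q(\mathcal{T}(p,2))$ is the quandle generated by the arc labels $x_1,\dots,x_p$ with the relations $x_2\triangleright x_1=x_p$, $x_1\triangleright x_p=x_{p-1}$, and $x_i\triangleright x_{i-1}=x_{i-2}$ for $3\le i\le p$; that is, $x_i\triangleright x_{i-1}=x_{i-2}$ for all $i$, with indices read modulo $p$. An $X$-quandle coloring of an oriented link $K$ is an element of $Hom(Q(K),X)$; it is trivial if it uses a single color (all arcs are sent to the same element of $X$) and nontrivial otherwise. For a finite quandle $X$ and an oriented link $K$, the full $X$-quandle coloring quiver $\mathcal{Q}_X(K)$ is the directed multigraph (loops and multiple edges allowed) with one vertex $v_f$ for each $f\in Hom(Q(K),X)$ and, for each $\phi\in Hom(X,X)$ with $g=\phi\circ f$, one directed edge from $v_f$ to $v_g$. Thus the number of edges from $v_f$ to $v_g$ is the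 number of $\phi\in Hom(X,X)$ with $g=\phi\circ f$. $(\overleftrightarrow{K_m},\hat{k})$ denotes the directed multigraph on $m$ vertices having exactly $k$ directed edges from each vertex to every vertex, including exactly $k$ loops at each vertex. For directed multigraphs $G_1,G_2$ on disjoint vertex sets, $G_1\overleftarrow{\nabla}_{\hat{k}}G_2$ is the directed multigraph on $V(G_1)\cup V(G_2)$ containing all edges of $G_1$ and of $G_2$, together with exactly $k$ directed edges from each vertex of $G_2$ to each vertex of $G_1$, and no edges from vertices of $G_1$ to vertices of $G_2$. *)

(* Defs.v *)
From HB Require Import structures.
From mathcomp Require Import all_boot zify boolp.

Set Implicit Arguments.
Unset Strict Implicit.
Unset Printing Implicit Defensive.

Local Open Scope nat_scope.

Record quandle := Quandle {
  qcarrier :> Type;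
  qop : qcarrier -> qcarrier -> qcarrier;
  quandle_nonempty : inhabited qcarrier;
  qop_idem : forall x, qop x x = x;
  qop_bij : forall y, bijective (fun x => qop x y);
  qop_dist : forall x y z, qop (qop x y) z = qop (qop x z) (qop y z)
}.

Record qhom (X Y : quandle) := QHom {
  qhom_fun :> X -> Y;
  qhomP : forall a b, qhom_fun (qop a b) = qop (qhom_fun a) (qhom_fun b)
}.

Lemma qhom_comp_subproof (X Y Z : quandle) (g : qhom Y Z) (f : qhom X Y) a b :
  g (f (qop a b)) = qop (g (f a)) (g (f b)).
Proof. by rewrite !qhomP. Qed.

Definition qhom_comp (X Y Z : quandle) (g : qhom Y Z) (f : qhom X Y) :
  qhom X Z := QHom (qhom_comp_subproof g f).

Section Dihedral.
Variables (n : nat) (hn : 1 < n).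

(* As x < n, the truncated subtraction below is exact, so this is
   (2y - x) mod n. *)
Definition dihedral_op (x y : 'I_n) : 'I_n :=
  Ordinal (ltn_pmod (2 * y + (n - x)) (ltnW hn)).

Lemma dihedral_opE (x y : 'I_n) : dihedral_op x y + x = 2 * y %[mod n].
Proof.
by rewrite modnDml -addnA subnK ?modnDr // ltnW.
Qed.

Lemma dihedral_op_unique (x y z : 'I_n) :
  z + x = 2 * y %[mod n] -> dihedral_op x y = z.
Proof.
rewrite -(dihedral_opE x y) => /eqP; rewrite eqn_modDr => /eqP.
by rewrite !modn_small // => h; apply/val_inj.
Qed.

Lemma dihedral_idem x : dihedral_op x x = x.
Proof. by apply: dihedral_op_unique; rewrite mul2n addnn. Qed.

Lemma dihedral_invol y : involutive (fun x => dihedral_op x y).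
Proof.
by move=> x; apply: dihedral_op_unique; rewrite addnC dihedral_opE.
Qed.

Lemma dihedral_dist x y z :
  dihedral_op (dihedral_op x y) z =
  dihedral_op (dihedral_op x z) (dihedral_op y z).
Proof.
have cong2 i i' j j' : i = i' %[mod n] -> j = j' %[mod n] ->
    i + j = i' + j' %[mod n].
  by move=> ei ej; rewrite -modnDm ei ej modnDm.
apply: dihedral_op_unique; apply/eqP.
rewrite -(eqn_modDr (x + 2 * y + dihedral_op x z)); apply/eqP.
set a := dihedral_op (dihedral_op x z) (dihedral_op y z).
have ha : a + dihedral_op x z = 2 * dihedral_op y z %[mod n].
  exact: dihedral_opE.
have hxy := dihedral_opE x y; have hxz := dihedral_opE x z.
have hyz := dihedral_opE y z.
transitivity ((2 * dihedral_op y z + (2 * y + 2 * y)) %% n).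
  rewrite -(cong2 _ _ _ _ ha (cong2 _ _ _ _ hxy (erefl (2 * y %% n)))).
  by congr (_ %% _); lia.
transitivity ((2 * z + 2 * z + 2 * y) %% n).
  rewrite -(cong2 _ _ _ _ (cong2 _ _ _ _ hyz hyz) (erefl (2 * y %% n))).
  by congr (_ %% _); lia.
rewrite -addnA -(cong2 _ _ _ _ hxz (erefl ((2 * z + 2 * y) %% n))).
by congr (_ %% _); lia.
Qed.

Definition dihedral : quandle :=
  @Quandle 'I_n dihedral_op (inhabits (Ordinal (ltnW hn)))
    dihedral_idem (fun y => inv_bij (dihedral_invol y)) dihedral_dist.
End Dihedral.

Local Open Scope quotient_scope.

(* Formal words over a set G of generators; TOpV x y denotes the unique z with
   z |> y = x. *)
Inductive qterm (G : Type) :=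
| TGen of G
| TOp of qterm G & qterm G
| TOpV of qterm G & qterm G.

HB.instance Definition _ (G : Type) := gen_eqMixin (qterm G).
HB.instance Definition _ (G : Type) := gen_choiceMixin (qterm G).

Section Presented.
Variables (G : Type) (G0 : inhabited G) (rels : qterm G -> qterm G -> Prop).

(* The least congruence containing the relations and the quandle axioms. *)
Inductive qcong : qterm G -> qterm G -> Prop :=
| qcong_rel s t : rels s t -> qcong s t
| qcong_refl s : qcong s s
| qcong_sym s t : qcong s t -> qcong t s
| qcong_trans s t u : qcong s t -> qcong t u -> qcong s u
| qcong_op s s' t t' :
    qcong s s' -> qcong t t' -> qcong (TOp s t) (TOp s' t')
| qcong_opV s s' t t' :
    qcong s s' -> qcong t t' -> qcong (TOpV s t) (TOpV s' t')
| qcong_idem s : qcong (TOp s s) s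
| qcong_opK s t : qcong (TOpV (TOp s t) t) s
| qcong_opVK s t : qcong (TOp (TOpV s t) t) s
| qcong_dist s t u : qcong (TOp (TOp s t) u) (TOp (TOp s u) (TOp t u)).

Definition qcongb : rel (qterm G) := fun s t => `[< qcong s t >].

Lemma qcongb_refl : reflexive qcongb.
Proof. by move=> s; apply/asboolP; exact: qcong_refl. Qed.

Lemma qcongb_sym : symmetric qcongb.
Proof. by move=> s t; apply/asboolP/asboolP; exact: qcong_sym. Qed.

Lemma qcongb_trans : transitive qcongb.
Proof.
move=> t s u /asboolP st /asboolP tu; apply/asboolP.
exact: qcong_trans st tu.
Qed.

Canonical qcongb_equiv := EquivRel qcongb qcongb_refl qcongb_sym qcongb_trans.

Definition presented_carrier : Type := {eq_quot qcongb}.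

Definition presented_class (s : qterm G) : presented_carrier :=
  \pi_({eq_quot qcongb}) s.

Definition presented_repr (a : presented_carrier) : qterm G :=
  repr (a : {eq_quot qcongb}).

Definition presented_op (a b : presented_carrier) : presented_carrier :=
  presented_class (TOp (presented_repr a) (presented_repr b)).

Lemma presented_classP s t :
  presented_class s = presented_class t <-> qcong s t.
Proof.
by split=> [/eqmodP/asboolP | st]; [ | apply/eqmodP/asboolP].
Qed.

Lemma presented_reprK a : presented_class (presented_repr a) = a.
Proof. exact: reprK. Qed.

Lemma presented_opE s t :
  presented_op (presented_class s) (presented_class t) =
  presented_class (TOp s t).
Proof.
by apply/presented_classP; apply: qcong_op;
   apply/presented_classP; rewrite presented_reprK.
Qed.

Lemma presented_nonempty : inhabited presented_carrier.
Proof. by case: G0 => g; exact: (inhabits (presented_class (TGen g))). Qed.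

Lemma presented_idem a : presented_op a a = a.
Proof.
rewrite -(presented_reprK a) presented_opE.
by apply/presented_classP; exact: qcong_idem.
Qed.

Lemma presented_bij b : bijective (fun a => presented_op a b).
Proof.
rewrite -(presented_reprK b).
pose t := presented_repr b; rewrite -/t.
exists (fun a => presented_class (TOpV (presented_repr a) t)) => a.
- rewrite -{2}(presented_reprK a); apply/presented_classP.
  apply: qcong_trans (qcong_opK _ t); apply: qcong_opV (qcong_refl _).
  by apply/presented_classP; rewrite presented_reprK -presented_opE
    presented_reprK.
- rewrite presented_opE -{2}(presented_reprK a).
  by apply/presented_classP; exact: qcong_opVK.
Qed.

Lemma presented_dist a b c :
  presented_op (presented_op a b) c =
  presented_op (presented_op a c) (presented_op b c).
Proof.
rewrite -(presented_reprK a) -(presented_reprK b) -(presented_reprK c).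
by rewrite !presented_opE; apply/presented_classP; exact: qcong_dist.
Qed.

Definition presented_quandle : quandle :=
  Quandle presented_nonempty presented_idem presented_bij presented_dist.

Definition presented_gen (g : G) : presented_quandle :=
  presented_class (TGen g).
End Presented.

(* Arcs are indexed by 'I_p, i.e. by the residues modulo p; ord_pred is the
   cyclic predecessor. *)
Inductive torus2_rel (p : nat) : qterm 'I_p -> qterm 'I_p -> Prop :=
| Torus2Rel (i : 'I_p) :
    torus2_rel (TOp (TGen i) (TGen (ord_pred i)))
               (TGen (ord_pred (ord_pred i))).

(* The fundamental quandle of the closure of the 2-strand braid sigma_1^p. *)
Definition torus2_quandle (p : nat) (hp : 0 < p) : quandle :=
  presented_quandle (inhabits (Ordinal hp)) (@torus2_rel p).

Definition torus2_arc (p : nat) (hp : 0 < p) (i : 'I_p) : torus2_quandle hp :=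
  presented_gen (inhabits (Ordinal hp)) (@torus2_rel p) i.

Definition trivial_coloring (p : nat) (hp : 0 < p) (X : quandle)
    (f : qhom (torus2_quandle hp) X) : Prop :=
  exists x : X, forall i : 'I_p, f (torus2_arc hp i) = x.

Record multidigraph := Multidigraph {
  vertex : Type;
  edge : Type;
  esrc : edge -> vertex;
  etgt : edge -> vertex
}.

Record multidigraph_iso (A B : multidigraph) := MultidigraphIso {
  iso_vertex : vertex A -> vertex B;
  iso_edge : edge A -> edge B;
  iso_vertex_bij : bijective iso_vertex;
  iso_edge_bij : bijective iso_edge;
  iso_src : forall e, esrc (iso_edge e) = iso_vertex (esrc e);
  iso_tgt : forall e, etgt (iso_edge e) = iso_vertex (etgt e)
}.

(* The edge given by (f, phi) goes from f to phi \o f. *)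
Definition coloring_quiver (Q X : quandle) : multidigraph :=
  @Multidigraph (qhom Q X) (qhom Q X * qhom X X)%type
    (fun e => e.1) (fun e => qhom_comp e.2 e.1).

Definition complete_multidigraph (m k : nat) : multidigraph :=
  @Multidigraph 'I_m ('I_m * 'I_m * 'I_k)%type
    (fun e => e.1.1) (fun e => e.1.2).

(* The k additional edges for each pair go from A2 to A1. *)
Definition join_multidigraph (k : nat) (A1 A2 : multidigraph) : multidigraph :=
  @Multidigraph (vertex A1 + vertex A2)%type
    (edge A1 + edge A2 + vertex A2 * vertex A1 * 'I_k)%type
    (fun e => match e with
              | inl (inl e1) => inl (esrc e1)
              | inl (inr e2) => inr (esrc e2)
              | inr (v2, _, _) => inr v2
              end)
    (fun e => match e with
              | inl (inl e1) => inl (etgt e1)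
              | inl (inr e2) => inr (etgt e2)
              | inr (_, v1, _) => inl v1
              end).

(* Main.v *)
Require Import Defs.
From mathcomp Require Import all_boot all_algebra zify ring boolp.

Set Implicit Arguments.
Unset Strict Implicit.
Unset Printing Implicit Defensive.

Import GRing.Theory.

(** In the dihedral quandle Z_n the operation is x |> y = 2y - x, so the
    relation between three consecutive arcs of T(p,2) says that their colors
    form an arithmetic progression. A coloring is therefore the same thing as
    a first color a and a slope b with p b = 0 in Z_n ([coloringE],
    [slope_period], [coloring_exists]); since c = gcd(p,n), the condition on b
    is that d = n/c divides it ([period_dvdn]), and b = 0 is triviality. This
    gives n trivial and n(c-1) nontrivial colorings
    ([coloring_vertex_bijection]).

    The same recursion, run along 0, 1, 2, ... in Z_n, shows that the
    endomorphisms of Z_n are the affine maps x |-> u + w x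
    ([endomorphismE], [endomorphism_exists]). Such a map sends the coloring
    (a, b) to (u + w a, w b). Hence the edges from (a, b) to (a', b')
    correspond to the solutions w of w b = b', with u = a' - w a then
    determined. If b = 0, then either b' <> 0 and there is no solution, or
    b' = 0 and all n values of w are solutions. If b = j d <> 0 and b' = j' d,
    the equation becomes w j = j' modulo c; as c is prime, j is invertible
    modulo c, so w is determined modulo c and has d = n/c values in Z_n,
    which the quotient of w by c tells apart ([factor_exists],
    [factor_unique]).

    To turn these multiplicities into an isomorphism of multigraphs, the edges
    between any two vertices are numbered 0, 1, 2, ... on both sides; a
    bijection of vertices that respects multiplicities then extends to edges by
    matching numbers ([multidigraph_iso_numbering]). *)

(** * Directed multigraphs with numbered edges *)

Lemma inj_surj_bijective (S T : Type) (f : S -> T) :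
  injective f -> (forall y, exists x, f x = y) -> bijective f.
Proof.
move=> finj /choice[g gK]; exists g => // x.
by apply: finj; rewrite gK.
Qed.

(** A way to say that there are exactly [mult u v] edges from [u] to [v]
    without a finiteness structure on the type of edges. *)
Definition edge_numbering (A : multidigraph) (mult : vertex A -> vertex A -> nat)
    (num : edge A -> nat) : Prop :=
  [/\ forall e, num e < mult (esrc e) (etgt e),
      forall u v i, i < mult u v ->
        exists e, [/\ esrc e = u, etgt e = v & num e = i]
    & forall e e', esrc e = esrc e' -> etgt e = etgt e' -> num e = num e' ->
        e = e'].

(** Two multigraphs with the same edge multiplicities are isomorphic: each
    edge goes to the unique edge with the corresponding ends and the same
    number. *)
Lemma multidigraph_iso_numbering (A B : multidigraph) mult numA numB
    (h : vertex A -> vertex B) :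
    bijective h -> edge_numbering mult numB ->
    edge_numbering (fun u v => mult (h u) (h v)) numA ->
  exists theta : multidigraph_iso A B, iso_vertex theta = h.
Proof.
move=> hbij [ltB surjB injB] [ltA surjA injA].
have /choice[k kP] (e : edge A) : exists e' : edge B,
    [/\ esrc e' = h (esrc e), etgt e' = h (etgt e) & numB e' = numA e].
  by apply: surjB; apply: ltA.
have kbij : bijective k.
  apply: inj_surj_bijective => [e e' kee'|e'].
    have [[s1 t1 n1] [s2 t2 n2]] := (kP e, kP e').
    by apply: injA; rewrite -?n1 -?n2 ?kee' //; apply: (bij_inj hbij);
      rewrite -?s1 -?s2 -?t1 -?t2 kee'.
  have [g hK gK] := hbij.
  have [|e [es et en]] := surjA (g (esrc e')) (g (etgt e')) (numB e').
    by rewrite !gK; apply: ltB.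
  exists e; have [s1 t1 n1] := kP e.
  by apply: injB; rewrite ?s1 ?t1 ?n1 ?es ?et ?gK.
by exists (MultidigraphIso hbij kbij (fun e => let: And3 s _ _ := kP e in s)
  (fun e => let: And3 _ t _ := kP e in t)).
Qed.

Definition join_complete_mult (k1 k2 k : nat) (V1 V2 : Type)
    (u v : V1 + V2) : nat :=
  match u, v with
  | inl _, inl _ => k1
  | inl _, inr _ => 0
  | inr _, inl _ => k
  | inr _, inr _ => k2
  end.

Lemma join_complete_numbering m1 m2 k1 k2 k :
  @edge_numbering
    (join_multidigraph k (complete_multidigraph m1 k1)
                         (complete_multidigraph m2 k2))
    (@join_complete_mult k1 k2 k 'I_m1 'I_m2)
    (fun e => match e with
              | inl (inl e1) => e1.2
              | inl (inr e2) => e2.2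
              | inr e3 => e3.2
              end).
Proof.
split.
- by move=> [[[[u v] i]|[[u v] i]]|[[u v] i]] /=.
- move=> [u|u] [v|v] i //= lti.
  + by exists (inl (inl (u, v, Ordinal lti))).
  + by exists (inr (u, v, Ordinal lti)).
  + by exists (inl (inr (u, v, Ordinal lti))).
- by move=> [[[[u v] i]|[[u v] i]]|[[u v] i]]
    [[[[u' v'] i']|[[u' v'] i']]|[[u' v'] i']] //= [<-] [<-] /val_inj <-.
Qed.

(** * Homomorphisms from a presented quandle *)

Lemma qhom_ext (X Y : quandle) (f g : qhom X Y) : f =1 g -> f = g.
Proof.
case: f g => [f fP] [g gP] /= /funext efg; rewrite efg in fP *.
by congr QHom; apply: Prop_irrelevance.
Qed.

Lemma qop_inj (X : quandle) (y : X) : injective (fun x => qop x y).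
Proof. exact/bij_inj/qop_bij. Qed.

Lemma qop_surj (X : quandle) (x y : X) : exists z, qop z y = x.
Proof. by have [g _ gK] := qop_bij y; exists (g x); apply: gK. Qed.

(** The inverse of a right translation is only known to exist, so it is
    chosen; it interprets the formal operation [TOpV]. *)
Definition qopV (X : quandle) (x y : X) : X := sval (cid (qop_surj x y)).

Lemma qopVK (X : quandle) (x y : X) : qop (qopV x y) y = x.
Proof. exact: svalP (cid (qop_surj x y)). Qed.

Section Presented.
Variables (G : Type) (G0 : inhabited G) (rels : qterm G -> qterm G -> Prop).
Variable X : quandle.

Fixpoint qeval (v : G -> X) (s : qterm G) : X :=
  match s with
  | TGen g => v g
  | TOp s t => qop (qeval v s) (qeval v t)
  | TOpV s t => qopV (qeval v s) (qeval v t)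
  end.

(** Every quandle satisfies the axioms that generate the congruence, so only
    the given relations have to be checked. *)
Lemma qeval_qcong (v : G -> X) :
    (forall s t, rels s t -> qeval v s = qeval v t) ->
  forall s t, qcong rels s t -> qeval v s = qeval v t.
Proof.
move=> vrels s t; elim=> //=.
- by move=> ? ? ? _ -> _ ->.
- by move=> ? ? ? ? _ -> _ ->.
- by move=> ? ? ? ? _ -> _ ->.
- by move=> ?; apply: qop_idem.
- by move=> a b; apply: (@qop_inj X (qeval v b)); rewrite /= qopVK.
- by move=> ? ?; apply: qopVK.
- by move=> ? ? ?; apply: qop_dist.
Qed.

Lemma presented_qhom_exists (v : G -> X) :
    (forall s t, rels s t -> qeval v s = qeval v t) ->
  exists f : qhom (presented_quandle G0 rels) X,
    forall g, f (presented_gen G0 rels g) = v g.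
Proof.
move=> /qeval_qcong vP.
have evalE s : qeval v (presented_repr (presented_class rels s)) = qeval v s.
  by apply: vP; apply/presented_classP; rewrite presented_reprK.
have fP (a b : presented_quandle G0 rels) : qeval v (presented_repr (qop a b)) =
    qop (qeval v (presented_repr a)) (qeval v (presented_repr b)).
  exact: evalE.
by exists (QHom fP) => g; apply: evalE.
Qed.

(** The one case that is not immediate from the homomorphism property is
    [TOpV s t]: its image is pinned down by what it becomes after acting by
    [t], because right translations are injective. *)
Lemma presented_qhom_unique (f g : qhom (presented_quandle G0 rels) X) :
    (forall x, f (presented_gen G0 rels x) = g (presented_gen G0 rels x)) ->
  f = g.
Proof.
move=> efg; apply: qhom_ext => a; rewrite -(presented_reprK a).
have opE s t : presented_class rels (TOp s t) = @qop (presented_quandle G0 rels)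
    (presented_class rels s) (presented_class rels t).
  by rewrite /= presented_opE.
elim: (presented_repr a) => [x|s IHs t IHt|s IHs t IHt]; first exact: efg.
  by rewrite opE !qhomP IHs IHt.
have sE : @qop (presented_quandle G0 rels) (presented_class rels (TOpV s t))
    (presented_class rels t) = presented_class rels s.
  by rewrite -opE; apply/presented_classP; apply: qcong_opVK.
apply: (@qop_inj X (f (presented_class rels t))).
by rewrite /= -qhomP IHt -qhomP sE.
Qed.

End Presented.

(** * Colorings of (p,2)-torus links as arithmetic progressions *)

Section Colorings.
Variables (p m : nat) (hp : 0 < p) (hn : 1 < m.+2).
(* For n of the form m.+2, the type of residues is a commutative ring. *)
Local Notation n := m.+2.
Local Notation Zn := (dihedral hn).
Local Notation QT := (torus2_quandle hp).

Local Open Scope ring_scope.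

Lemma dihedral_opZp (x y : 'I_n) : dihedral_op hn x y = y *+ 2 - x.
Proof.
apply: dihedral_op_unique.
have -> : ((y *+ 2 - x)%R + x)%N = nat_of_ord (y *+ 2 - x + x)%R %[mod n].
  by rewrite /= modn_mod.
by rewrite subrK Zp_mulrn /= mulnC modn_mod.
Qed.

Lemma val_mulZp (x y : 'I_n) : val (x * y) = ((x : nat) * y %% n)%N.
Proof. by []. Qed.

(** Used twice: for the colors of consecutive arcs and for the values of an
    endomorphism at consecutive integers. *)
Lemma arithmetic_progressionE (R : comPzRingType) (s : nat -> R) :
    (forall k, s k.+2 = s k.+1 *+ 2 - s k) ->
  forall k, s k = s 0%N + (s 1%N - s 0%N) *+ k.
Proof.
move=> sS k; have [] // : s k = s 0%N + (s 1%N - s 0%N) *+ k /\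
  s k.+1 = s 0%N + (s 1%N - s 0%N) *+ k.+1.
elim: k => [|k [IH0 IH1]]; first by split; ring.
by split=> //; rewrite sS IH1 IH0; ring.
Qed.

(** Indexing the arcs by all natural numbers lets the wrap-around from the last
    arc to the first become periodicity of a sequence. *)
Definition arc_mod (k : nat) : QT := torus2_arc hp (Ordinal (ltn_pmod k hp)).

Lemma arc_modE (i : 'I_p) : torus2_arc hp i = arc_mod i.
Proof. by congr torus2_arc; apply: val_inj; rewrite /= modn_small. Qed.

Definition start (f : qhom QT Zn) : 'I_n := f (arc_mod 0).
Definition slope (f : qhom QT Zn) : 'I_n := (f (arc_mod 1) : 'I_n) - start f.

Lemma coloring_step (f : qhom QT Zn) k :
  (f (arc_mod k.+2) : 'I_n) = (f (arc_mod k.+1) : 'I_n) *+ 2 - (f (arc_mod k) : 'I_n).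
Proof.
have predE j : ord_pred (Ordinal (ltn_pmod j.+1 hp)) = Ordinal (ltn_pmod j hp).
  rewrite -[RHS]ordSK; congr ord_pred; apply: val_inj => /=.
  by rewrite -addn1 -modnDml addn1.
have arcE : qop (arc_mod k.+2) (arc_mod k.+1) = arc_mod k.
  rewrite /arc_mod /torus2_arc /= presented_opE.
  apply/presented_classP; apply: qcong_rel.
  by have := Torus2Rel (Ordinal (ltn_pmod k.+2 hp)); rewrite !predE.
have := qhomP f (arc_mod k.+2) (arc_mod k.+1); rewrite arcE /= dihedral_opZp => ->.
by rewrite subKr.
Qed.

Lemma coloringE (f : qhom QT Zn) k :
  (f (arc_mod k) : 'I_n) = start f + slope f *+ k.
Proof.
exact: (arithmetic_progressionE (s := fun j => f (arc_mod j) : 'I_n)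
  (coloring_step f)).
Qed.

(** Going once around the link returns to the first arc. *)
Lemma slope_period (f : qhom QT Zn) : slope f *+ p = 0.
Proof.
apply: (addrI (start f)); rewrite -coloringE addr0.
by congr (f (torus2_arc _ _)); apply: val_inj; rewrite /= modnn mod0n.
Qed.

Lemma coloring_inj (f g : qhom QT Zn) :
  start f = start g -> slope f = slope g -> f = g.
Proof.
move=> e0 e1; apply: presented_qhom_unique => i.
by rewrite -[presented_gen _ _ _]/(torus2_arc hp i) arc_modE !coloringE e0 e1.
Qed.

(** Since p b = 0, the color a + i b depends only on i modulo p, so the
    relations that cross the end of the cyclic order hold like the others. *)
Lemma coloring_exists (a b : 'I_n) : b *+ p = 0 ->
  exists f : qhom QT Zn, start f = a /\ slope f = b.
Proof.
move=> bp0.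
have modE k : b *+ (k %% p) = b *+ k.
  by rewrite [in RHS](divn_eq k p) mulrnDr mulnC mulrnA bp0 mul0rn add0r.
have predE (i : 'I_p) : b *+ ord_pred i = b *+ i - b.
  rewrite /= modE; apply: (addIr b); rewrite subrK -mulrSr prednK.
    by rewrite mulrnDr bp0 addr0.
  by rewrite addn_gt0 hp orbT.
have [|f fE] := @presented_qhom_exists _ (inhabits (Ordinal hp)) (@torus2_rel p) Zn
    (fun i => a + b *+ i).
  move=> _ _ [i]; rewrite [LHS]dihedral_opZp /=.
  suff: (a + b *+ ord_pred i) *+ 2 - (a + b *+ i) =
      a + b *+ ord_pred (ord_pred i) by [].
  by rewrite !predE; ring.
exists f; have startE : start f = a.
  by rewrite /start [LHS]fE /= mod0n addr0.
split=> //; rewrite /slope startE [X in X - _]fE /= modE; ring.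
Qed.

Lemma trivial_coloring_slope (f : qhom QT Zn) :
  trivial_coloring f <-> slope f = 0.
Proof.
split=> [[x fx]|b0]; first by rewrite /slope /start !fx subrr.
by exists (start f) => i; rewrite arc_modE coloringE b0 mul0rn addr0.
Qed.

(** * Endomorphisms of dihedral quandles as affine maps *)

Definition shift (phi : qhom Zn Zn) : 'I_n := phi (0 : 'I_n).
Definition factor (phi : qhom Zn Zn) : 'I_n := (phi (1 : 'I_n) : 'I_n) - shift phi.

Lemma endomorphismE (phi : qhom Zn Zn) (x : 'I_n) :
  (phi x : 'I_n) = shift phi + factor phi * x.
Proof.
have sS k : (phi (k.+2%:R : 'I_n) : 'I_n) =
    (phi (k.+1%:R : 'I_n) : 'I_n) *+ 2 - (phi (k%:R : 'I_n) : 'I_n).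
  have -> : (k.+2%:R : 'I_n) = @qop Zn (k%:R : 'I_n) (k.+1%:R : 'I_n).
    by rewrite /= dihedral_opZp; ring.
  by rewrite qhomP [LHS]dihedral_opZp.
have xE : x = (x%:R : 'I_n) by rewrite Zp_nat /= valZpK.
rewrite [in RHS]xE mulr_natr [in LHS]xE.
exact: (arithmetic_progressionE (s := fun j => phi (j%:R : 'I_n) : 'I_n) sS).
Qed.

Lemma endomorphism_inj (phi psi : qhom Zn Zn) :
  shift phi = shift psi -> factor phi = factor psi -> phi = psi.
Proof.
by move=> e0 e1; apply: qhom_ext => x; rewrite !endomorphismE e0 e1.
Qed.

Lemma endomorphism_exists (u w : 'I_n) :
  exists phi : qhom Zn Zn, shift phi = u /\ factor phi = w.
Proof.
have fP (x y : Zn) : (u + w * (qop x y : 'I_n)) =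
    @qop Zn (u + w * (x : 'I_n)) (u + w * (y : 'I_n)).
  by rewrite /= !dihedral_opZp; ring.
by exists (@QHom Zn Zn (fun x : 'I_n => u + w * x) fP);
  rewrite /factor /shift /=; split; ring.
Qed.

Lemma start_comp (phi : qhom Zn Zn) (f : qhom QT Zn) :
  start (qhom_comp phi f) = shift phi + factor phi * start f.
Proof. exact: endomorphismE. Qed.

Lemma slope_comp (phi : qhom Zn Zn) (f : qhom QT Zn) :
  slope (qhom_comp phi f) = factor phi * slope f.
Proof.
rewrite /slope start_comp [X in X - _]endomorphismE; ring.
Qed.

(** * Counting solutions modulo a prime gcd *)

Local Close Scope ring_scope.
Hypothesis c_prime : prime (gcdn p n).
Local Notation c := (gcdn p n).
Local Notation d := (n %/ c).

(** Dividing n | b p by c gives d | b (p/c), and d is coprime to p/c. *)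
Lemma period_dvdn (b : 'I_n) : (b *+ p = 0)%R <-> d %| b.
Proof.
have c_gt0 : 0 < c := prime_gt0 c_prime.
have co : coprime d (p %/ c).
  rewrite /coprime -(eqn_pmul2r c_gt0) muln_gcdl !divnK ?dvdn_gcdl ?dvdn_gcdr //.
  by rewrite mul1n gcdnC.
have -> : (d %| b) = (n %| b * p).
  rewrite -(Gauss_dvdl b co) -(dvdn_pmul2r c_gt0) -mulnA !divnK //.
    exact: dvdn_gcdl.
  exact: dvdn_gcdr.
rewrite Zp_mulrn; split=> [/(congr1 val)|/eqP h]; last exact/val_inj.
by move=> h; apply/eqP.
Qed.

Lemma slopeE (f : qhom QT Zn) : slope f = slope f %/ d * d :> nat.
Proof. by rewrite divnK //; apply/period_dvdn/slope_period. Qed.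

Lemma gcd_quotient_gt0 : 0 < d.
Proof. by rewrite divn_gt0 ?prime_gt0 // dvdn_leq // dvdn_gcdr. Qed.

Lemma gcd_quotientK : d * c = n.
Proof. by rewrite divnK // dvdn_gcdr. Qed.

Lemma mul_slope_eq (w w' : nat) (j j' : nat) :
  (w * (j * d) == w' * (j' * d) %[mod n]) = (w * j == w' * j' %[mod c]).
Proof.
have modE x : (x * d) %% n = (x %% c) * d.
  by rewrite muln_modl [c * d]mulnC gcd_quotientK.
by rewrite !mulnA !modE eqn_pmul2r // gcd_quotient_gt0.
Qed.

(** This is where primality of c enters: a nonzero slope j d
    has 0 < j < c, hence j is a unit modulo c. *)
Lemma slope_index_inverse (f : qhom QT Zn) : slope f <> 0%R ->
  exists u, u * (slope f %/ d) = 1 %[mod c].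
Proof.
set j := slope f %/ d => f_neq0.
have j_gt0 : 0 < j.
  rewrite lt0n; apply/eqP => j0; apply: f_neq0; apply: val_inj.
  by rewrite [LHS]slopeE -/j j0.
have ltjc : j < c by rewrite ltn_divLR ?gcd_quotient_gt0 // mulnC gcd_quotientK.
have co : coprime j c by rewrite coprime_sym prime_coprime // gtnNdvd.
case: (egcdnP c j_gt0) => u v uj _; exists u.
by rewrite uj (eqP co) modnMDl.
Qed.

(** The residue of the factor modulo c is forced by the slopes; its quotient
    by c can be prescribed freely. *)
Lemma factor_exists (f g : qhom QT Zn) (i : nat) :
    slope f <> 0%R -> i < d ->
  exists w : 'I_n, (w * slope f = slope g)%R /\ w %/ c = i.
Proof.
move=> f_neq0 ltid; have c_gt0 : 0 < c := prime_gt0 c_prime.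
have [u uj] := slope_index_inverse f_neq0.
set j := slope f %/ d in uj; set j' := slope g %/ d.
(* u * j' solves w * j = j' modulo c, because u is the inverse of j. *)
have ltw : i * c + (u * j') %% c < n.
  rewrite -[X in _ < X]gcd_quotientK.
  apply: (@leq_trans (i.+1 * c)); last by rewrite leq_mul2r ltid orbT.
  by rewrite mulSn addnC ltn_add2r ltn_pmod.
have [w wE] : exists w : 'I_n, w = i * c + (u * j') %% c :> nat.
  by exists (Ordinal ltw).
exists w; split; last by rewrite wE divnMDl // divn_small ?addn0 // ltn_mod.
apply: val_inj; rewrite [LHS]val_mulZp wE -[RHS](modn_small (ltn_ord (slope g))).
rewrite [in LHS]slopeE [in RHS]slopeE -/j -/j'.
apply/eqP; rewrite -[j' * d]mul1n mul_slope_eq mul1n; apply/eqP.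
by rewrite -modnMml modnMDl modn_mod modnMml mulnAC -modnMml uj modnMml mul1n.
Qed.

Lemma factor_unique (f : qhom QT Zn) (w w' : 'I_n) :
    slope f <> 0%R -> (w * slope f = w' * slope f)%R -> w %/ c = w' %/ c ->
  w = w'.
Proof.
move=> f_neq0 /(congr1 val)/eqP; rewrite !val_mulZp slopeE mul_slope_eq.
have [u uj] := slope_index_inverse f_neq0.
set j := slope f %/ d in uj * => /eqP ejj ediv; apply: val_inj => /=.
have cancel_j (x : nat) : x = x * j * u %[mod c].
  by rewrite -mulnA -modnMmr [j * u]mulnC uj modnMmr muln1.
rewrite (divn_eq w c) (divn_eq w' c) ediv; congr (_ + _).
by rewrite (cancel_j w) (cancel_j w') -modnMml ejj modnMml.
Qed.

(** * The quiver and the join *)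

(** The factor of an endomorphism determines the edge once its ends are fixed;
    out of a nontrivial coloring only its quotient by c is free. *)
Definition endo_number (f : qhom QT Zn) (phi : qhom Zn Zn) : nat :=
  if slope f == 0%R then factor phi : nat else factor phi %/ c.

Definition coloring_mult (f g : qhom QT Zn) : nat :=
  if slope f == 0%R then (if slope g == 0%R then n else 0) else d.

Lemma coloring_quiver_numbering :
  @edge_numbering (coloring_quiver QT Zn) coloring_mult
    (fun e => endo_number e.1 e.2).
Proof.
split.
- move=> [f phi]; rewrite /= /coloring_mult /endo_number slope_comp.
  case: eqP => [->|_]; first by rewrite mulr0 eqxx.
  by rewrite ltn_divLR ?prime_gt0 // gcd_quotientK ltn_ord.
- move=> f g i; rewrite /= /coloring_mult => lti.
  suff [w [ws wi]] : exists w : 'I_n, (w * slope f = slope g)%R /\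
      (if slope f == 0%R then w : nat else w %/ c) = i.
    have [phi [phi0 phi1]] := endomorphism_exists (start g - w * start f)%R w.
    exists (f, phi); split=> //=; last by rewrite /endo_number phi1.
    apply: coloring_inj; last by rewrite slope_comp phi1.
    by rewrite start_comp phi0 phi1 subrK.
  move: lti; case: eqP => [-> |/eqP f_neq0]; last by apply/factor_exists/eqP.
  case: eqP => // ->  lti; exists (Ordinal lti); split=> //=; exact: mulr0.
- move=> [f phi] [f' psi] /= <-; rewrite /endo_number => eg en.
  have e0 := congr1 start eg; have e1 := congr1 slope eg.
  have ef : factor phi = factor psi.
    move: en; rewrite !slope_comp in e1; case: eqP => [_ /val_inj //|f_neq0].
    exact: (factor_unique f_neq0 e1).
  congr (_, _); apply: endomorphism_inj => //.
  by move: e0; rewrite !start_comp ef => /addIr.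
Qed.

(** The vertex v of the second summand is read in base c - 1: its leading digit
    is the first color and its last digit is j - 1, where j d is the slope. *)
Lemma coloring_vertex_bijection :
  exists h : qhom QT Zn -> 'I_n + 'I_(n * (c - 1)),
    bijective h /\ forall f, slope f = 0%R <-> exists v, h f = inl v.
Proof.
have c1_gt0 : 0 < c - 1 by rewrite subn_gt0 prime_gt1.
have d_gt0 := gcd_quotient_gt0.
pose coords (v : 'I_n + 'I_(n * (c - 1))) : nat * nat := match v with
  | inl a => (a : nat, 0)
  | inr v => (v %/ (c - 1), (v %% (c - 1)).+1 * d)
  end.
have coords_inj : injective coords.
  move=> [a|v] [a'|v'] //=.
  - by case=> /val_inj ->.
  - by case=> _; lia.
  - by case=> _; lia.
  - case=> ediv /eqP; rewrite eqn_pmul2r // => /eqP[emod].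
    congr inr; apply: val_inj => /=.
    by rewrite (divn_eq v (c - 1)) ediv emod -divn_eq.
have /choice[g gP] v : exists f, (start f : nat, slope f : nat) = coords v.
  have [lt1 lt2 dv] : [/\ (coords v).1 < n, (coords v).2 < n & d %| (coords v).2].
    case: v => [a|v] /=; first by rewrite dvdn0.
    rewrite ltn_divLR // ltn_ord dvdn_mull //; split=> //.
    rewrite -[X in _ < X]gcd_quotientK mulnC ltn_pmul2l //.
    by have := ltn_pmod v c1_gt0; lia.
  have [|f [f0 f1]] := @coloring_exists (Ordinal lt1) (Ordinal lt2).
    exact/period_dvdn.
  by exists f; rewrite f0 f1 /=; case: (coords v).
have coords_surj f : exists v, coords v = (start f : nat, slope f : nat).
  have := slopeE f; have : slope f %/ d < c.
    by rewrite ltn_divLR // mulnC gcd_quotientK.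
  case: (slope f %/ d) => [_ ->|j ltjc ->]; first by exists (inl (start f)).
  have ltj : j < c - 1 by rewrite ltn_subRL.
  have ltv : start f * (c - 1) + j < n * (c - 1).
    apply: (@leq_trans ((start f).+1 * (c - 1))).
      by rewrite mulSn addnC ltn_add2r.
    by rewrite leq_pmul2r.
  exists (inr (Ordinal ltv)) => /=.
  by rewrite divnMDl // divn_small // addn0 modnMDl modn_small.
have gbij : bijective g.
  apply: inj_surj_bijective => [v v' egg|f].
    by apply: coords_inj; rewrite -!gP egg.
  have [v vf] := coords_surj f; exists v.
  have := gP v; rewrite vf => -[e0 e1].
  by apply: coloring_inj; apply: val_inj.
have [h gK hK] := gbij; exists h; split; first by exists g.
move=> f; have e1 : slope f = (coords (h f)).2 :> nat by rewrite -gP hK.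
case: (h f) e1 => [a|v] e1.
  by split=> _; [exists a | apply: val_inj].
by split=> [b0|[]//]; move: e1; rewrite b0 [LHS]/= [RHS]/= mulSn; lia.
Qed.

End Colorings.

Theorem theorem9 (p n : nat) (hp : (0 < p)%N) (hn : (1 < n)%N) :
  let c := gcdn p n in
  let d := (n %/ c)%N in
  prime c ->
  exists theta : multidigraph_iso
      (coloring_quiver (torus2_quandle hp) (dihedral hn))
      (join_multidigraph d (complete_multidigraph n n)
                           (complete_multidigraph (n * (c - 1)) d)),
    (forall f : qhom (torus2_quandle hp) (dihedral hn),
        trivial_coloring f <->
        exists v : 'I_n, iso_vertex theta f = inl v) /\
    (forall f : qhom (torus2_quandle hp) (dihedral hn),
        ~ trivial_coloring f <->
        exists v : 'I_(n * (c - 1)), iso_vertex theta f = inr v).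
Proof.
case: n hn => [|[|m]] // hn c d c_prime.
have [h [hbij hP]] := coloring_vertex_bijection hp hn c_prime.
have multE : (fun f g => join_complete_mult m.+2 d d (h f) (h g)) =
    @coloring_mult p m hp hn.
  apply/funext=> f; apply/funext=> g.
  rewrite /coloring_mult; have := hP f; have := hP g.
  case: (h f) => [a|v]; case: (h g) => [a'|v'] gP fP.
  - by rewrite (proj2 fP) ?(proj2 gP) ?eqxx //; [exists a' | exists a].
  - rewrite (proj2 fP) ?eqxx; last by exists a.
    by case: eqP => // /(proj1 gP)[].
  - by case: eqP => // /(proj1 fP)[].
  - by case: eqP => // /(proj1 fP)[].
have numA := coloring_quiver_numbering hp hn c_prime.
rewrite -multE in numA.
have [theta thetaE] := @multidigraph_iso_numbering
  (coloring_quiver (torus2_quandle hp) (dihedral hn))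
  (join_multidigraph d (complete_multidigraph m.+2 m.+2)
                       (complete_multidigraph (m.+2 * (c - 1)) d))
  _ _ _ h hbij (join_complete_numbering _ _ m.+2 d d) numA.
exists theta; rewrite thetaE; split=> f; rewrite trivial_coloring_slope hP //.
case: (h f) => [a|v]; split=> [|[]] //; last by move=> _ _ [].
  by case; exists a.
by exists v.
Qed.
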